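(* Let $\Delta=[n]$ be a finite ground set. For every set system $\Omega\subseteq\mathscr P(\Delta)$ we have $$\mathcal C(\widehat{\overline\Omega})\subseteq\Omega\subseteq\mathcal C(\widehat{\overline{\uparrow\Omega}}),$$ where $\mathcal C(\widehat{\overline\Omega})$ and $\mathcal C(\widehat{\overline{\uparrow\Omega}})$ are the tightest inner and outer approximations of $\Omega$ using upper-systems, respectively; that is, $\mathcal C(\widehat{\overline\Omega})$ is the largest (with respect to inclusion) upper-closed set system contained in $\Omega$, and $\mathcal C(\widehat{\overline{\uparrow\Omega}})$ is the smallest upper-closed set system containing $\Omega$. Moreover, equality holds throughout if and only if $\Omega$ is upper-closed.
   Context: $\mathscr P(\Delta)$ is the power set of $\Delta$, and a set system is any subset $\Omega\subseteq\mathscr P(\Delta)$. $\Omega$ is upper-closed (an upper-system) if $T\in\Omega$ and $T\subseteq T'\subseteq\Delta$ imply $T'\in\Omega$. Operators on set systems: $\uparrow\Omega:=\{T\subseteq\Delta\mid T\supseteq T'\text{ for some }T'\in\Omega\}$; $\overline\Omega:=\mathscr P(\Delta)\setminus\Omega$; $\widehat\Omega:=\{\Delta\setminus T\mid T\in\Omega\}$; $\mathcal C(\Omega):=\{S\subseteq\Delta\mid S\cap T\neq\emptyset\ \forall T\in\Omega\}$. Here $\widehat{\overline\Omega}$ means the operator $\widehat{(\cdot)}$ applied to $\overline\Omega$. *)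

(* Defs.v *)
From mathcomp Require Import all_boot.

Set Implicit Arguments.
Unset Strict Implicit.
Unset Printing Implicit Defensive.

(* A set system on a finite ground set D is an element of {set {set D}}, so the
   complement of a set system in the power set of D is finset's [~: Omega]. *)
Section SetSystems.
Variable D : finType.
Implicit Types (Omega Psi : {set {set D}}) (S T : {set D}).

Definition upper_closed Omega : Prop :=
  forall T T', T \in Omega -> T \subset T' -> T' \in Omega.

Definition up_closure Omega : {set {set D}} :=
  [set T : {set D} | [exists T' in Omega, T' \subset T]].

(* Complements each member within D, as opposed to [~: Omega]. *)
Definition memberwise_compl Omega : {set {set D}} :=
  [set ~: T | T in Omega].

Definition transversals Omega : {set {set D}} :=
  [set S : {set D} | [forall T in Omega, S :&: T != set0]].

(* Greatest, resp. least, for inclusion; finset's [maxset] and [minset] only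
   express maximality and minimality. *)
Definition is_largest (P : {set {set D}} -> Prop) Omega : Prop :=
  P Omega /\ forall Psi, P Psi -> Psi \subset Omega.

Definition is_smallest (P : {set {set D}} -> Prop) Omega : Prop :=
  P Omega /\ forall Psi, P Psi -> Omega \subset Psi.

End SetSystems.

(* Main.v *)
Require Import Defs.
From mathcomp Require Import all_boot.

(** A set [S] misses the complement of [T] exactly when [S \subset T].  So [S]
    meets the complement of every set outside [Omega] exactly when no superset
    of [S] lies outside [Omega]: this is [transversals_complP], and it says
    that the operator sending [Omega] to
    [transversals (memberwise_compl (~: Omega))] is an interior operator whose
    open sets are the upper-systems.  The inner half of the theorem is the
    usual property of an interior.  For the outer half, [up_closure Omega] is
    already upper-closed, hence equal to its own interior, so the outer
    approximation is just [up_closure Omega]. *)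

Section UpperApproximations.
Variable D : finType.
Implicit Types (Omega Psi : {set {set D}}) (S T : {set D}).

Lemma transversals_complP Omega S :
  reflect (forall T, S \subset T -> T \in Omega)
          (S \in transversals (memberwise_compl (~: Omega))).
Proof.
rewrite inE; apply: (iffP forall_inP) => [meetS T sST | supS _ /imsetP[T + ->]].
  apply: contraT => TnOmega.
  have /meetS : ~: T \in memberwise_compl (~: Omega).
    by apply: imset_f; rewrite inE.
  by rewrite setI_eq0 disjoints_subset setCK sST.
rewrite inE => TnOmega; rewrite setI_eq0 disjoints_subset setCK.
by apply: contra TnOmega; apply: supS.
Qed.

Lemma transversals_compl_sub Omega :
  transversals (memberwise_compl (~: Omega)) \subset Omega.
Proof. by apply/subsetP => S /transversals_complP; apply. Qed.

Lemma transversals_compl_upper Omega :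
  upper_closed (transversals (memberwise_compl (~: Omega))).
Proof.
move=> S S' /transversals_complP supS sSS'; apply/transversals_complP => T sS'T.
exact: supS (subset_trans sSS' sS'T).
Qed.

Lemma transversals_compl_max Omega Psi :
  upper_closed Psi -> Psi \subset Omega ->
  Psi \subset transversals (memberwise_compl (~: Omega)).
Proof.
move=> upPsi /subsetP sPsi; apply/subsetP => S SPsi.
by apply/transversals_complP => T sST; apply/sPsi/(upPsi S).
Qed.

Lemma transversals_compl_id Omega :
  upper_closed Omega -> transversals (memberwise_compl (~: Omega)) = Omega.
Proof.
move=> upOmega; apply/eqP; rewrite eqEsubset transversals_compl_sub.
exact: transversals_compl_max.
Qed.

Lemma sub_up_closure Omega : Omega \subset up_closure Omega.
Proof.
by apply/subsetP => T TOmega; rewrite inE; apply/exists_inP; exists T.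
Qed.

Lemma up_closure_upper Omega : upper_closed (up_closure Omega).
Proof.
move=> T T'; rewrite !inE => /exists_inP[T0 T0Omega sT0T] sTT'.
by apply/exists_inP; exists T0 => //; apply: subset_trans sTT'.
Qed.

Lemma up_closure_min Omega Psi :
  upper_closed Psi -> Omega \subset Psi -> up_closure Omega \subset Psi.
Proof.
move=> upPsi /subsetP sOmega; apply/subsetP => T.
by rewrite inE => /exists_inP[T0 /sOmega T0Psi]; apply: upPsi.
Qed.

Lemma up_closure_id Omega : upper_closed Omega -> up_closure Omega = Omega.
Proof.
move=> upOmega; apply/eqP; rewrite eqEsubset sub_up_closure andbT.
exact: up_closure_min.
Qed.

End UpperApproximations.

Theorem theorem1 (n : nat) (Omega : {set {set 'I_n}}) :
  let inner := transversals (memberwise_compl (~: Omega)) in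
  let outer := transversals (memberwise_compl (~: up_closure Omega)) in
  [/\ inner \subset Omega /\ Omega \subset outer,
      is_largest (fun Psi => upper_closed Psi /\ Psi \subset Omega) inner,
      is_smallest (fun Psi => upper_closed Psi /\ Omega \subset Psi) outer
    & (inner = Omega /\ Omega = outer) <-> upper_closed Omega].
Proof.
move=> inner outer.
have outerE : outer = up_closure Omega.
  exact/transversals_compl_id/up_closure_upper.
have sInner : inner \subset Omega := transversals_compl_sub _ Omega.
have upInner : upper_closed inner := transversals_compl_upper _ Omega.
rewrite outerE; split.
- by split=> //; apply: sub_up_closure.
- by split=> // Psi [upPsi sPsi]; apply: transversals_compl_max.
- split; first by split; [apply: up_closure_upper | apply: sub_up_closure].
  by move=> Psi [upPsi sOmega]; apply: up_closure_min.
- split=> [[<- _] // | upOmega].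
  by split; [apply: transversals_compl_id | rewrite up_closure_id].
Qed.
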